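(* For every integer $d\ge 2$, the hypercube $Q_d$ is an MPF graph.
   Context: The hypercube $Q_d$ is the graph with vertex set $\{0,1\}^d$ in which two vertices are adjacent if and only if their Hamming distance is $1$. All graphs are finite. A simple graph is an undirected graph without loops or multiple edges. A labeling of a graph on $N$ vertices is a bijection from its vertex set to $\{1,\ldots,N\}$; it determines the adjacency matrix $A(\cdot)$. A simple graph $X$ on $N$ vertices is an MPF (matrix product factorizable) graph if there exist simple graphs $G$ and $H$ on $N$ vertices and labelings of $G$, $H$ and $X$ such that, with respect to these labelings, $A(G)A(H)=A(X)$. *)

(* Defs.v *)
From HB Require Import structures.
From mathcomp Require Import all_boot all_order all_algebra.

Set Implicit Arguments.
Unset Strict Implicit.
Unset Printing Implicit Defensive.

Import GRing.Theory.
Local Open Scope ring_scope.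

Record sgraph := SGraph {
  vertex :> finType;
  adj : rel vertex;
  adj_sym : symmetric adj;
  adj_irr : irreflexive adj
}.

(* Labels are 0, ..., N-1 (the ordinals 'I_N) rather than 1, ..., N.
   Bijectivity forces G to have exactly N vertices. *)
Record labeling (G : sgraph) (N : nat) := Labeling {
  label :> G -> 'I_N;
  label_bij : bijective label
}.

(* Since l is a bijection, the entry (i, j) is 1 when the unique vertices
   labeled i and j are adjacent, and 0 otherwise. *)
Definition adjmx (G : sgraph) (N : nat) (l : labeling G N) : 'M[int]_N :=
  \matrix_(i < N, j < N)
    ([exists u : G, exists v : G, [&& l u == i, l v == j & adj u v]] : nat)%:R.

Definition MPF (X : sgraph) : Prop :=
  exists (G H : sgraph)
         (lG : labeling G #|X|) (lH : labeling H #|X|) (lX : labeling X #|X|),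
    adjmx lG *m adjmx lH = adjmx lX.

Definition hamming (d : nat) (x y : {ffun 'I_d -> bool}) : nat :=
  #|[set k | x k != y k]|.

Definition hypercube_adj (d : nat) : rel {ffun 'I_d -> bool} :=
  fun x y => hamming x y == 1%N.

Lemma hypercube_adj_sym (d : nat) : symmetric (@hypercube_adj d).
Proof.
move=> x y; rewrite /hypercube_adj /hamming; congr (_ == _).
by apply: eq_card => k; rewrite !inE eq_sym.
Qed.

Lemma hypercube_adj_irr (d : nat) : irreflexive (@hypercube_adj d).
Proof.
move=> x; rewrite /hypercube_adj /hamming.
by rewrite (_ : [set k | _] = set0) ?cards0 //; apply/setP => k; rewrite !inE eqxx.
Qed.

Definition hypercube (d : nat) : sgraph :=
  SGraph (@hypercube_adj_sym d) (@hypercube_adj_irr d).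

(* Main.v *)
Require Import Defs.
From mathcomp Require Import all_boot all_order all_algebra.

Import GRing.Theory.

(** Suppose a graph [X] has an involutive automorphism [f] that moves every
    vertex to a different, non-adjacent vertex, and let [P] be its permutation
    matrix. Then [P] is the adjacency matrix of the perfect matching
    [{x, f x}]. As [f] is an automorphism and an involution, [A(X) P] is
    symmetric, and its diagonal is zero because no [x] is adjacent to [f x];
    so it is the adjacency matrix of a simple graph as well. Finally
    [(A(X) P) P = A(X)] because [P ^ 2 = 1].

    In the hypercube such an [f] is the antipodal map, which flips all
    coordinates: it preserves Hamming distances and moves each vertex to
    distance [d], which is neither [0] nor [1] when [d >= 2]. *)

Lemma adjmx_label {G : sgraph} {N : nat} (l : labeling G N) (u v : G) :
  adjmx l (l u) (l v) = ((adj u v : nat)%:R)%R.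
Proof.
have l_inj := bij_inj (label_bij l).
rewrite mxE; congr (((_ : bool) : nat)%:R)%R; apply/existsP/idP.
  by case=> u' /existsP[v' /and3P[/eqP/l_inj -> /eqP/l_inj ->]].
by move=> uv; exists u; apply/existsP; exists v; rewrite !eqxx.
Qed.

Section InvolutiveAutomorphism.

Variables (X : sgraph) (f : X -> X).
Hypothesis f_invol : involutive f.
Hypothesis f_aut : forall x y, adj (f x) (f y) = adj x y.
Hypothesis f_move : forall x, f x != x.
Hypothesis f_nonadj : forall x, ~~ adj x (f x).

Lemma twist_sym : symmetric (fun x y : X => adj x (f y)).
Proof. by move=> x y; rewrite -f_aut f_invol adj_sym. Qed.

Lemma twist_irr : irreflexive (fun x y : X => adj x (f y)).
Proof. by move=> x; apply: negbTE. Qed.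

Lemma matching_sym : symmetric (fun x y : X => f x == y).
Proof. by move=> x y; rewrite (inv_eq f_invol) eq_sym. Qed.

Lemma matching_irr : irreflexive (fun x y : X => f x == y).
Proof. by move=> x; apply: negbTE. Qed.

(** The factors are the graph with matrix [A(X) P] and the matching with
    matrix [P], where [P] is the permutation matrix of [f]. One enumeration
    of the vertices labels all three graphs, since they share a vertex type. *)
Lemma involutive_aut_MPF : MPF X.
Proof.
pose G := SGraph twist_sym twist_irr; pose H := SGraph matching_sym matching_irr.
pose lG : labeling G #|X| := @Labeling G #|X| enum_rank (@enum_rank_bij X).
pose lH : labeling H #|X| := @Labeling H #|X| enum_rank (@enum_rank_bij X).
pose lX : labeling X #|X| := @Labeling X #|X| enum_rank (@enum_rank_bij X).
exists G, H, lG, lH, lX; apply/matrixP => i j.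
rewrite -[i]enum_valK -[j]enum_valK.
move: (enum_val i) (enum_val j) => u v.
rewrite (adjmx_label lX) mxE (reindex lX) /=; last first.
  exact/onW_bij/(label_bij lX).
(* The only neighbour of [v] in the matching is [f v]. *)
rewrite (bigD1 (f v)) //= big1 => [|w w_neq].
  by rewrite (adjmx_label lG) (adjmx_label lH) /= !f_invol eqxx mulr1 addr0.
by rewrite (adjmx_label lH) /= (inv_eq f_invol) (negbTE w_neq) mulr0.
Qed.

End InvolutiveAutomorphism.

Definition antipode {d : nat} (x : {ffun 'I_d -> bool}) : {ffun 'I_d -> bool} :=
  [ffun k => ~~ x k].

Lemma antipodeK (d : nat) : involutive (@antipode d).
Proof. by move=> x; apply/ffunP => k; rewrite !ffunE negbK. Qed.

Lemma hamming_antipode {d : nat} (x y : {ffun 'I_d -> bool}) :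
  hamming (antipode x) (antipode y) = hamming x y.
Proof.
by apply: eq_card => k; rewrite !inE !ffunE (inj_eq negb_inj).
Qed.

Lemma hamming_to_antipode {d : nat} (x : {ffun 'I_d -> bool}) :
  hamming x (antipode x) = d.
Proof.
rewrite -[RHS]card_ord; apply: eq_card => k.
by rewrite !inE ffunE; case: (x k).
Qed.

Lemma hammingxx (d : nat) (x : {ffun 'I_d -> bool}) : hamming x x = 0.
Proof. by apply: eq_card0 => k; rewrite !inE eqxx. Qed.

Theorem theorem3p29 (d : nat) (hd : (2 <= d)%N) : MPF (hypercube d).
Proof.
apply: (@involutive_aut_MPF (hypercube d) antipode).
- exact: antipodeK.
- by move=> x y; rewrite /= /hypercube_adj hamming_antipode.
- move=> x; apply/eqP => xE; move: (hamming_to_antipode x) hd.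
  by rewrite xE hammingxx => <-.
- by move=> x; rewrite /= /hypercube_adj hamming_to_antipode; case: d hd x => [|[]].
Qed.
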